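(* Let $T\subset\ell^2$ be finite. Let the integer $\sigma$ be large enough (fixed depending on $r$). If the functions $f_{n,j}:T\to\mathbb{R}^+$ ($n\in\mathbb{N}$, $j\in\mathbb{Z}$) satisfy the $\sigma$-growth condition for points, then $$\gamma(T)\lesssim_r\Bigl(\sup_{u\in T,\,n,\,j}f_{n,j}(u)+r^{-j_0(T)}\Bigr).$$
   Context: **Process and balls.** $(Y_i)_{i\ge1}$ are independent symmetric random variables; $U_i(x)=-\log\mathsf{P}\{|Y_i|\ge x\}$ is convex with $U_i(0)=0$, $U_i(1)=1$, and for a fixed constant $C_0$: $U_i(2s)\le C_0U_i(s)$ for all $i$ and $s\ge1$, and $U_i'(0)\ge1/C_0$ for all $i$ (right derivative). $\hat U_i(x)=x^2$ for $|x|\le1$, $\hat U_i(x)=2U_i(|x|)-1$ for $|x|\ge1$; $\mathcal{N}_u(t)=\sup\{\sum_it_ia_i:\sum_i\hat U_i(a_i)\le u\}$; $B(u)=\{t\in\ell^2:\mathcal{N}_u(t)\le u\}$ for $u>0$. $r=2^{\kappa-3}$, where $\kappa\ge5$ is an integer large enough that $B(8ru)\subset\rho rB(u)$ for all $u>0$ with some $\rho<\frac1{10}$. $\varphi_j(s,t)=\inf\{u>0:s-t\in r^{-j}B(u)\}$; $B_j(s,c)=\{t\in T:\varphi_j(s,t)\le c\}$. $N_0=1$, $N_n=2^{2^n}$ for $n\ge1$; $r^{-\infty}=0$. $A\lesssim_rB$ means $A\le C(r)B$ with $C(r)$ depending only on $r$ ($C_0$ being fixed). **The functional $\gamma$.**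 For $A\subset T$, $j_n(A)=\sup\{j\in\mathbb{Z}:\varphi_j(x,y)\le2^n\ \forall x,y\in A\}$ (in particular $j_0(T)$ is this quantity for $n=0$, $A=T$). An admissible sequence is an increasing (successively refining) sequence $(\mathcal{A}_n)_{n\ge0}$ of partitions of $T$ with $|\mathcal{A}_n|\le N_n$; $A_n(t)$ is the element of $\mathcal{A}_n$ containing $t$. $\gamma(T)=\inf_{(\mathcal{A}_n)}\sup_{t\in T}\sum_{n\ge0}2^nr^{-j_n(A_n(t))}$. **$\sigma$-growth condition for points.** Let $\sigma\ge0$ be an integer. Functions $f_{n,j}:T\to\mathbb{R}^+$ satisfy it if (a) $f_{n,j}\ge\max\{f_{n+\kappa,j+1},f_{n,j+1}\}$ pointwise for all $n,j$; (b) for all $n\ge0$ and $j\le j_0(T)-\sigma-3$, $f_{n,j}=\sup\{f_{m,l}:m\ge0,\ l\ge j_0(T)-\sigma-2\}$ (pointwise on $T$); (c) for all $n,j$ and all points $(t_i)_{i\le N_{n+\kappa}}$ of $T$ such that $\varphi_{j+2}(t_i/8,t_{i'}/8)>2^{n+\kappa}$ for all $i\ne i'$, and such that there is $u\in T$ with $t_i\in B_{j-\sigma}(u,2^n)$ for all $i$, one has (for such $u$) $$f_{n,j-\sigma-1}(u)\ge2^nr^{-j}+\min_{i\le N_{n+\kappa}}f_{n+\kappa,j+2}(t_i).$$ *)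

(* Defs.v *)
From HB Require Import structures.
From mathcomp Require Import all_boot all_order all_algebra finmap.
From mathcomp Require Import all_classical all_reals all_analysis.

Set Implicit Arguments.
Unset Strict Implicit.
Unset Printing Implicit Defensive.

Import Order.TTheory GRing.Theory Num.Theory.
Import numFieldNormedType.Exports.

Local Open Scope classical_set_scope.
Local Open Scope ring_scope.

(* Real sequences [nat -> R] are indexed from 0, so index [i] here is the
   index [i + 1] of a sequence (x_i)_{i >= 1}. *)

Section Process.
Context (d : measure_display) (R : realType) (Omega : measurableType d)
  (P : probability Omega R).

Definition mutually_independent (Y : nat -> {RV P >-> R}) : Prop :=
  forall (J : {fset nat}) (A : nat -> set R), (forall i, measurable (A i)) ->
    P (\bigcap_(i in [set` J]) (Y i @^-1` A i)) =
    (\prod_(i <- J) fine (P (Y i @^-1` A i)))%:E.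

Definition symmetric_rv (X : {RV P >-> R}) : Prop :=
  forall A : set R, measurable A ->
    P [set w | A (X w)] = P [set w | A (- X w)].

(* U(x) = - log P{|X| >= x}.  In the library ln 0 = 0, so U is 0, and not +oo,
   where the tail vanishes.  This does no harm under the hypotheses of
   [process_hypotheses]: with U 0 = 0 and U 1 = 1, convexity forces x <= U x
   for x >= 1, so the tail never vanishes. (A tail with U = +oo somewhere would
   also violate the doubling condition.) *)
Definition tail_exponent (X : {RV P >-> R}) (x : R) : R :=
  - ln (fine (P [set w | x <= `|X w|])).

Record process_hypotheses (C0 : R) (Y : nat -> {RV P >-> R}) : Prop := {
  ph_independent : mutually_independent Y;
  ph_symmetric : forall i, symmetric_rv (Y i);
  ph_convex : forall i,
    @convex_function R R^o `[0, +oo[ (tail_exponent (Y i));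
  ph_at0 : forall i, tail_exponent (Y i) 0 = 0;
  ph_at1 : forall i, tail_exponent (Y i) 1 = 1;
  ph_doubling : forall i s, 1 <= s ->
    tail_exponent (Y i) (2 * s) <= C0 * tail_exponent (Y i) s;
  ph_deriv0 : forall i, exists2 l : R,
    (tail_exponent (Y i) h - tail_exponent (Y i) 0) / h @[h --> 0^'+] --> l &
    C0^-1 <= l }.

End Process.

Section Geometry.
Context {R : realType}.
Implicit Types (U : nat -> R -> R) (s t : nat -> R) (T A : set (nat -> R)).

Definition ell2 : set (nat -> R) :=
  [set t | (\sum_(0 <= i <oo) (t i ^+ 2)%:E < +oo)%E].

Definition hatU (V : R -> R) (x : R) : R :=
  if `|x| <= 1 then x ^+ 2 else 2 * V `|x| - 1.

(* For t in l^2 and the functions U at hand, each series sum_i t_i a_i below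
   converges absolutely: \sum_i hatU_i(a_i) < +oo forces a to be in l^2. *)
Definition normN U (u : R) t : \bar R :=
  ereal_sup [set (limn (series (fun i => t i * a i)))%:E | a in
    [set a : nat -> R | (\sum_(0 <= i <oo) (hatU (U i) (a i))%:E <= u%:E)%E]].

Definition ballB U (u : R) : set (nat -> R) :=
  [set t | ell2 t /\ (normN U u t <= u%:E)%E].

Definition dilate (c : R) A : set (nat -> R) :=
  [set (fun i => c * t i) | t in A].

(* The infimum is +oo when no u > 0 is suitable. *)
Definition phi U (r : R) (j : int) s t : \bar R :=
  ereal_inf [set u%:E | u in
    [set u : R | 0 < u /\ dilate (r ^ (- j)) (ballB U u) (s \- t)]].

Definition phi_ball U (r : R) T (j : int) s (c : R) : set (nat -> R) :=
  [set t | T t /\ (phi U r j s t <= c%:E)%E].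

(* An extended integer: j_n(A) = +oo when A has at most one point. *)
Definition jsup U (r : R) (n : nat) A : \bar R :=
  ereal_sup [set (j%:~R)%:E | j in
    [set j : int | forall x y, A x -> A y ->
      (phi U r j x y <= (2 ^+ n)%:E)%E]].

(* r ^ (- x) for an extended number x, with r ^ (- +oo) = 0. *)
Definition rpowN (r : R) (x : \bar R) : \bar R :=
  match x with
  | y%:E => (r `^ (- y))%:E
  | +oo%E => 0%E
  | -oo%E => +oo%E
  end.

Definition Nn (n : nat) : nat := if n is 0%N then 1%N else (2 ^ (2 ^ n))%N.

(* Supremum in [0, +oo]; the supremum of the empty set is 0. *)
Definition nnsup (S : set (\bar R)) : \bar R := ereal_sup (0%E |` S).

Record admissible T (AA : nat -> set (set (nat -> R))) : Prop := {
  adm_partition : forall n, partition (AA n) id T;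
  adm_card : forall n, (AA n #<= `I_(Nn n))%card;
  adm_refine : forall n A, AA n.+1 A -> exists2 A', AA n A' & A `<=` A' }.

(* [pblock (AA n) id t] is the element A_n(t) of AA n containing t. *)
Definition gamma U (r : R) T : \bar R :=
  ereal_inf [set nnsup [set (\sum_(0 <= n <oo)
      (2 ^+ n)%:E * rpowN r (jsup U r n (pblock (AA n) id t)))%E | t in T]
    | AA in admissible T].

(* In the last condition the [inf] ranges over a finite nonempty set of
   reals, so it is a minimum. *)
Record growth_condition U (r : R) (kappa sigma : nat) T
    (f : nat -> int -> (nat -> R) -> R) : Prop := {
  gc_mono : forall n (j : int) t, T t ->
    Num.max (f (n + kappa)%N (j + 1) t) (f n (j + 1) t) <= f n j t;
  gc_flat : forall n (j : int) t, T t ->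
    ((j%:~R)%:E <= jsup U r 0 T - (sigma + 3)%:R%:E)%E ->
    (f n j t)%:E = nnsup [set x | exists m (l : int),
      (jsup U r 0 T - (sigma + 2)%:R%:E <= (l%:~R)%:E)%E /\
      x = (f m l t)%:E];
  gc_growth : forall n (j : int) (t : 'I_(Nn (n + kappa)) -> nat -> R) u,
    (forall i, T (t i)) ->
    (forall i i', i != i' ->
      ((2 ^+ (n + kappa))%:E <
        phi U r (j + 2) (fun k => t i k / 8)%R (fun k => t i' k / 8)%R)%E) ->
    T u ->
    (forall i, phi_ball U r T (j - sigma%:Z) u (2 ^+ n) (t i)) ->
    2 ^+ n * r ^ (- j) + inf (range (fun i => f (n + kappa)%N (j + 2) (t i)))
      <= f n (j - sigma%:Z - 1) u }.

End Geometry.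

(* Main.v *)
(* Write q = 2^kappa = 8r.  At time m * kappa every cell A of the partition
   carries an integer J with phi_J <= q^m on A x A.  Split A greedily into
   N_{(m+1) kappa} pieces: repeatedly pick a point maximizing
   f_{(m+1) kappa, J+sigma+2} and remove the phi_{J+sigma+1}-ball of radius q^m
   around it.  Balls get the integer J + sigma.  What is left at the end keeps
   J, but by the growth condition every t in it satisfies
     f_{(m+1) kappa, J+sigma+2}(t) + q^m r^{-J-sigma} <= f_{m kappa, J-1}(t).
   Along a point t put a_m = q^m r^{-J_m}; then sum_m a_m is at most three times
   its sum over the dominant indices n, those with a_l <= 2^|n-l| a_n for all
   l.  A ball step decreases a, so each dominant n > 0 is preceded by a step
   with a gain; moreover J_n - n is strictly increasing along dominant indices
   because q > 2r.  Hence, taking every (sigma+2)-th dominant index, the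
   monotonicity f_{n+kappa,j+1}, f_{n,j+1} <= f_{n,j} makes the gains telescope,
   and the sum of the a_n over dominant n > 0 is O(sup f). *)
Require Import Defs.
From mathcomp Require Import all_boot all_order all_algebra.
From mathcomp Require Import all_classical all_reals all_analysis.
From mathcomp Require Import zify ring lra.

Import Order.TTheory GRing.Theory Num.Theory.
Import numFieldNormedType.Exports.

Local Open Scope classical_set_scope.
Local Open Scope ring_scope.

(** * Dominant indices of a nonnegative sequence, and telescoping with skips *)

Section DominantIndices.
Context {R : realFieldType}.
Implicit Types (a x w : nat -> R) (M k l n p : nat).

Let dist n k := ((n - k) + (k - n))%N.

Definition dominant a M n :=
  [forall l : 'I_M, a l <= 2 ^+ dist n l * a n].

(** An index maximizing [2^-1 ^+ dist n k * a n] is dominant by the triangle inequality for [dist];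
    comparing it with [n = k] gives the second claim. *)
Lemma dominant_exists a M k : (k < M)%N -> (forall n, 0 <= a n) ->
  exists2 n : 'I_M, dominant a M n & a k <= 2^-1 ^+ dist n k * a n.
Proof.
move=> kM a0; pose F (n : 'I_M) := 2^-1 ^+ dist n k * a n.
have [n _ nmax] := @arg_maxP _ _ _ (Ordinal kM) xpredT F isT.
exists n; last first.
  by have := nmax (Ordinal kM) isT; rewrite /F /dist /= subnn expr0 mul1r.
apply/forallP => l; have := nmax l isT; rewrite /F => H.
have -> : a l = 2 ^+ dist l k * (2^-1 ^+ dist l k * a l).
  by rewrite mulrA -exprMn mulfV ?pnatr_eq0// expr1n mul1r.
apply: le_trans (_ : 2 ^+ dist l k * (2^-1 ^+ dist n k * a n) <= _).
  by rewrite ler_pM2l// exprn_gt0.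
rewrite mulrA; apply: ler_wpM2r => //.
rewrite exprVn ler_pdivrMr ?exprn_gt0// -exprD ler_weXn2l ?ler1n//.
by rewrite /dist; lia.
Qed.

(** Indices below [n], [n] itself and indices above [n] contribute at most 1 each. *)
Lemma sum_geometric_dist n M : \sum_(k < M) 2^-1 ^+ dist n k <= 3 :> R.
Proof.
have low m : (m <= n)%N ->
    \sum_(k < m) 2^-1 ^+ dist n k <= 2^-1 ^+ (n - m) :> R.
  elim: m => [|m IH] mn; first by rewrite big_ord0 exprn_ge0.
  rewrite big_ord_recr/=; apply: le_trans (lerD (IH (ltnW mn)) (lexx _)) _.
  have -> : dist n m = (n - m.+1).+1 by rewrite /dist; lia.
  have -> : (n - m = (n - m.+1).+1)%N by lia.
  by rewrite exprS; set y := _ ^+ _; lra.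
have high m : \sum_(k < n.+1 + m) 2^-1 ^+ dist n k <= 3 - 2^-1 ^+ m :> R.
  elim: m => [|m IH].
    rewrite addn0 big_ord_recr/= /dist !subnn expr0.
    by have := low n (leqnn n); rewrite subnn expr0; lra.
  rewrite addnS big_ord_recr/=; apply: le_trans (lerD IH (lexx _)) _.
  have -> : dist n (n + m).+1 = m.+1 by rewrite /dist; lia.
  by rewrite exprS; set y := _ ^+ _; lra.
have [nM|Mn] := ltnP n M.
  rewrite -(subnKC nM); apply: le_trans (high _) _.
  by rewrite lerBlDr lerDl exprn_ge0.
apply: le_trans (low _ Mn) _; apply: le_trans (_ : 1 <= _); last by lra.
by rewrite exprn_ile1//; lra.
Qed.

(** Charge each [a k] to one dominant [n] with weight [2^-1 ^+ dist n k]; the weights charged to a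
    given [n] sum to at most 3. *)
Lemma sum_le_dominant a M : (forall n, 0 <= a n) ->
  \sum_(k < M) a k <= 3 * \sum_(n < M | dominant a M n) a n.
Proof.
move=> a0.
apply: le_trans (_ : \sum_(k < M) \sum_(n < M | dominant a M n)
    2^-1 ^+ dist n k * a n <= _).
  apply: ler_sum => k _.
  have [n dn /le_trans] := dominant_exists a M k (ltn_ord k) a0; apply.
  rewrite (bigD1 n)//= lerDl sumr_ge0// => i _.
  by rewrite mulr_ge0 ?exprn_ge0.
rewrite exchange_big/= mulr_sumr; apply: ler_sum => n _.
by rewrite -mulr_suml ler_wpM2r// sum_geometric_dist.
Qed.

(** The gains split into [p] telescoping chains, one per residue class modulo [p], each worth at
    most [S]. *)
Lemma skip_telescope x w p L S :
  (forall i, 0 <= x i <= S) ->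
  (forall i, (i + p < L)%N -> x (i + p)%N + w i <= x i) ->
  (forall i, (i < L)%N -> w i <= x i) ->
  \sum_(i < L) w i <= p%:R * S.
Proof.
(* Cutting [x] off at [L] brings the last [p] indices into the common form
   [w i <= y i - y (p + i)]. *)
move=> xS xw wx; pose y i := if (i < L)%N then x i else 0.
have y0 i : 0 <= y i by rewrite /y; case: ifP => // _; case/andP: (xS i).
have yS i : y i <= S.
  by rewrite /y; case: ifP => _; case/andP: (xS i) => // /le_trans; apply.
have wy (i : 'I_L) : w i <= y i - y (p + i)%N.
  rewrite /y ltn_ord addnC; case: ifP => [/xw|_]; last by rewrite subr0 wx.
  by rewrite lerBrDl.
apply: (@le_trans _ _ (\sum_(i < L) (y i - y (p + i)%N))).
  by apply: ler_sum => i _; exact: wy.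
rewrite sumrB.
(* Splitting one sum as [p + L] and as [L + p] carries out the telescoping of all chains at once. *)
have : \sum_(i < p + L) y i = \sum_(i < L + p) y i by rewrite addnC.
rewrite !big_split_ord/= => /eqP.
have : 0 <= \sum_(i < p) y (L + i)%N by apply: sumr_ge0.
have : \sum_(i < p) y i <= p%:R * S.
  apply: (@le_trans _ _ (\sum_(i < p) S)); first by apply: ler_sum => i _.
  by rewrite sumr_const card_ord mulr_natl.
by move=> + + /eqP; lra.
Qed.

End DominantIndices.

(** * The weighted sum along one point [t], with [g m j] standing for [f (m * kappa) j t] *)

Section WeightedSum.
Context {R : realFieldType}.
Variables (r : R) (sigma : nat) (g : nat -> int -> R) (J : nat -> int) (S : R).
Hypothesis r_ge4 : 4 <= r.
Hypothesis sigma_ge4 : (4 <= sigma)%N.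
Hypothesis g_bound : forall m j, 0 <= g m j <= S.
Hypothesis g_diag : forall m j, g m.+1 (j + 1) <= g m j.
Hypothesis g_decr : forall m j, g m (j + 1) <= g m j.
Hypothesis step : forall m, J m.+1 = J m + sigma%:Z \/
  (J m.+1 = J m /\
   g m.+1 (J m + sigma%:Z + 2) + (8 * r) ^+ m * r ^ (- (J m + sigma%:Z))
     <= g m (J m - 1)).

Let a m := (8 * r) ^+ m * r ^ (- J m).

Let r_gt0 : 0 < r. Proof. exact: lt_le_trans r_ge4. Qed.

Let r_ge1 : 1 <= r. Proof. by apply: le_trans r_ge4; rewrite ler1n. Qed.

Let a_gt0 m : 0 < a m.
Proof.
by apply: mulr_gt0; [by rewrite exprn_gt0// mulr_gt0|exact: exprz_gt0].
Qed.

(** Make [d] diagonal moves by [g_diag] and [e - d] moves by [g_decr]. *)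
Let g_shift m j d e : (d <= e)%N -> g (m + d)%N (j + e%:Z) <= g m j.
Proof.
elim: d e => [|d IH] e de.
  rewrite addn0; elim: e de => [|e IHe] _; first by rewrite addr0.
  by apply: le_trans (IHe isT); rewrite -addn1 PoszD addrA.
case: e de => // e; rewrite ltnS => /IH; apply: le_trans.
by rewrite addnS -(addn1 e) PoszD addrA.
Qed.

(* A step increasing [J] multiplies [a] by [8 * r / r ^+ sigma < 1 / 2], so it
   cannot end at a dominant index. *)
Let dominant_step M n : (0 < n)%N -> (n < M)%N -> dominant a M n ->
  g n (J n + sigma%:Z + 2) + a n / (8 * r * r ^+ sigma) <= g n.-1 (J n - 1).
Proof.
case: n => // n _ nM /forallP/(_ (Ordinal (ltnW nM)))/=.
have -> : ((n.+1 - n) + (n - n.+1) = 1)%N by lia.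
have rN0 : r != 0 by rewrite gt_eqF.
have rs0 : r ^+ sigma != 0 by rewrite expf_neq0.
have rE j : r ^ (- (j + sigma%:Z)) = r ^ (- j) / r ^+ sigma.
  by rewrite opprD expfzDr// -exprnN.
rewrite expr1; case: (step n) => [Jn|[Jn H _]]; last first.
  (* When [J] is kept, [a n.+1 = 8 * r * a n], so the gain equals
     [a n.+1 / (8 * r * r ^+ sigma)]. *)
  rewrite Jn; apply: le_trans H; rewrite lerD2l /a Jn rE exprS le_eqVlt.
  apply/orP; left.
  move: (r ^ _) rs0 => z; move: (r ^+ _) => x x0.
  by apply/eqP; move: (_ ^+ n) => y; field; rewrite rN0 x0.
have aE : a n.+1 = a n * (8 * r / r ^+ sigma).
  rewrite /a Jn rE exprS; move: (r ^ _) (r ^+ _) (_ ^+ n) => x y z.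
  by ring.
move=> h; exfalso; move: h; apply/negP.
rewrite aE mulrCA -[X in X <= _]mulr1 ler_pM2l//.
rewrite mulrA ler_pdivlMr ?exprn_gt0// mul1r -ltNge.
(* What remains is [16 * r < r ^+ sigma]: since [r] and [sigma] are at least 4, the right side is at
   least [64 * r]. *)
have -> : sigma = (sigma - 4).+4 by lia.
have : 1 <= r ^+ (sigma - 4) by rewrite exprn_ege1.
rewrite !exprS; move: (_ ^+ _) => y y1.
have r16 : 16 <= r * r by have := r_ge4; nra.
have ry : 4 <= r * y by have := r_ge4; nra.
have := r_gt0; have : 64 <= r * (r * (r * y)).
  by rewrite mulrA; move: (r * r) (r * y) r16 ry => u v; nra.
by move: (r * (r * _)) => z; nra.
Qed.

(** If [J k <= J n + (k - n)], then [a k] is at least [(8 * r) ^+ (k - n) / r ^+ (k - n) = 8 ^+ (k -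
    n)] times [a n], which contradicts the factor [2 ^+ (k - n)] allowed by dominance of [n]. *)
Let dominant_gap M n k : (n < k)%N -> (k < M)%N -> dominant a M n ->
  J n + k.+1%:Z - n%:Z <= J k.
Proof.
move=> nk kM /forallP/(_ (Ordinal kM))/=.
have -> : ((n - k) + (k - n) = k - n)%N by lia.
move=> h; rewrite leNgt; apply/negP => Jk; move: h; apply/negP; rewrite -ltNge.
have -> : a k = (8 * r) ^+ (k - n) * (8 * r) ^+ n * r ^ (- J k).
  by rewrite -exprD subnK// ltnW.
have : r ^ (- J n) / r ^+ (k - n) <= r ^ (- J k).
  rewrite -[_^-1]/(r ^- (k - n)) exprnN -expfzDr ?gt_eqF//.
  by rewrite ler_weXz2l//; lia.
set y := r ^ _ => Hk.
have -> : (8 * r) ^+ (k - n) = 8 ^+ (k - n) * r ^+ (k - n) by rewrite exprMn.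
apply: lt_le_trans (_ : 8 ^+ (k - n) * r ^+ (k - n) * (8 * r) ^+ n *
    (r ^ (- J n) / r ^+ (k - n)) <= _); last first.
  by rewrite ler_wpM2l// !mulr_ge0// ?exprn_ge0 ?mulr_ge0 ?(ltW r_gt0).
have -> : 8 ^+ (k - n) * r ^+ (k - n) * (8 * r) ^+ n *
    (r ^ (- J n) / r ^+ (k - n)) = 8 ^+ (k - n) * a n.
  rewrite /a; set z := r ^ _; set x := r ^+ _; set v := (8 * r) ^+ _.
  have x0 : x != 0 by rewrite expf_neq0// gt_eqF.
  by field.
rewrite ltr_pM2r// ltr_pXn2r ?nnegrE// ?ltr_nat//.
by rewrite subn_gt0.
Qed.

Lemma weighted_sum_bound M :
  \sum_(m < M) a m <= 3 * (a 0 + (sigma + 2)%:R * S * (8 * r * r ^+ sigma)).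
Proof.
have S0 : 0 <= S by have /andP[] := g_bound 0 0; exact: le_trans.
have c_gt0 : 0 < 8 * r * r ^+ sigma by rewrite !mulr_gt0// exprn_gt0.
case: M => [|M].
  rewrite big_ord0 mulr_ge0//; apply: addr_ge0; first exact: ltW.
  by rewrite mulr_ge0 ?(ltW c_gt0)// mulr_ge0.
apply: le_trans (sum_le_dominant _ _ (fun n => ltW (a_gt0 n))) _.
(* Index 0 has no step before it, so [a 0] is set apart and bounded by itself. *)
rewrite ler_pM2l// -(big_mkord (dominant a M.+1)) big_ltn_cond//=.
set s := [seq n <- index_iota 1 M.+1 | dominant a M.+1 n].
rewrite -big_filter -/s.
have : \sum_(n <- s) a n <= (sigma + 2)%:R * S * (8 * r * r ^+ sigma).
  rewrite (big_nth 0%N) big_mkord.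
  set L := size s; pose N i := nth 0%N s i.
  have NP i : (i < L)%N ->
      [/\ (0 < N i)%N, (N i < M.+1)%N & dominant a M.+1 (N i)].
    move=> iL; have : N i \in s by exact: mem_nth.
    by rewrite mem_filter mem_index_iota => /and3P[dN N0 N1]; split.
  have Nmono i : (i.+1 < L)%N -> (N i < N i.+1)%N.
    move=> iL; have : sorted ltn s.
      by rewrite sorted_filter ?iota_ltn_sorted//; exact: ltn_trans.
    by move=> /(sortedP 0%N); apply.
  have gap i d : (i + d < L)%N ->
      J (N i) - (N i)%:Z + d%:Z <= J (N (i + d)%N) - (N (i + d)%N)%:Z /\
      (N i + d <= N (i + d))%N.
    elim: d => [|d IH] idL; first by rewrite !addn0 addr0; split.
    have [IH1 IH2] := IH ltac:(lia).
    have [? ? dd] := NP (i + d)%N ltac:(lia).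
    have [_ N1 _] := NP (i + d).+1 ltac:(lia).
    rewrite addnS in idL *.
    by have := dominant_gap _ _ _ (Nmono _ idL) N1 dd; have := Nmono _ idL; lia.
  rewrite -ler_pdivrMr// mulr_suml.
  apply: (skip_telescope (fun i => g (N i).-1 (J (N i) - 1))
    (fun i => a (N i) / (8 * r * r ^+ sigma))).
  - by move=> i.
  - move=> i iL.
    have [N0 N1 dd] := NP i ltac:(lia).
    have := dominant_step _ _ N0 N1 dd.
    have [G1 G2] := gap _ _ iL.
    move/(le_trans _); apply; rewrite lerD2r.
    (* By [gap], passing [sigma + 2] dominant indices makes the shift in [j] at least the shift in
       [m], as [g_shift] demands; this fixes the skip length. *)
    have := g_shift (N i) (J (N i) + sigma%:Z + 2)
      ((N (i + (sigma + 2))%N).-1 - N i)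
      (absz (J (N (i + (sigma + 2))%N) - 1 - (J (N i) + sigma%:Z + 2))%R).
    have -> : (N i + ((N (i + (sigma + 2))%N).-1 - N i) =
      (N (i + (sigma + 2))%N).-1)%N by lia.
    rewrite gez0_abs; last by lia.
    by rewrite subrKC; apply; lia.
  - move=> i iL; have [N0 N1 dd] := NP i iL.
    have := dominant_step _ _ N0 N1 dd.
    have /andP[+ _] := g_bound (N i) (J (N i) + sigma%:Z + 2).
    by move=> g0 /(le_trans _); apply; rewrite lerDr.
case: ifP => _ H; first by rewrite lerD2l.
by apply: le_trans H _; rewrite lerDr ltW.
Qed.

End WeightedSum.

(** * Greedy selection of separated points in a finite set *)

Section Greedy.
Context {R : realDomainType} {X : eqType}.

Lemma seq_argmax (h : X -> R) (l : seq X) : l != [::] ->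
  exists2 w, w \in l & forall s, s \in l -> h s <= h w.
Proof.
elim: l => // x l IH _; have [->|/IH[w wl wmax]] := eqVneq l [::].
  by exists x; rewrite ?mem_head// => s; rewrite inE => /eqP->.
have [xw|wx] := leP (h x) (h w).
  exists w; first by rewrite inE wl orbT.
  by move=> s; rewrite inE => /predU1P[->|/wmax].
exists x; rewrite ?mem_head// => s; rewrite inE => /predU1P[->//|/wmax].
by move=> /le_trans; apply; exact: ltW.
Qed.

(** Index [i < N] marks the points removed in round [i], index [N] the leftover. A leftover [s] was
    a candidate in every round, so each of the [N] centres beats it in [h]; together with [s] itself
    they form the [N.+1] separated points. *)
Lemma greedy_partition (D : X -> X -> Prop) (h : X -> R) (N : nat)
    (A : X -> Prop) (l : seq X) :
  (forall s t, D s t -> D t s) -> (forall s, A s -> s \in l) ->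
  exists idx : X -> nat,
  [/\ forall s, A s -> (idx s <= N)%N,
      forall s t, A s -> A t -> idx s = idx t -> (idx s < N)%N ->
        exists2 w, D w s & D w t &
      forall s, A s -> idx s = N -> exists t : 'I_N.+1 -> X,
        [/\ forall i, A (t i), forall i i', i != i' -> ~ D (t i) (t i') &
            forall i, h s <= h (t i)]].
Proof.
move=> Dsym; elim: N A => [|N IH] A Al.
  exists (fun=> 0%N); split=> // s As _; exists (fun=> s).
  by split=> // i i'; rewrite !ord1.
have [l0|lN0] := eqVneq [seq s <- l | `[< A s >]] [::].
  have A0 s : ~ A s.
    move=> As; have : s \in [seq s <- l | `[< A s >]].
      by rewrite mem_filter Al// andbT; exact/asboolP.
    by rewrite l0.
  by exists (fun=> 0%N); split=> [s As|s t As|s As]; case: (A0 s As).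
have [w] := seq_argmax h _ lN0.
rewrite mem_filter => /andP[/asboolP Aw _] wmax.
have {}wmax s : A s -> h s <= h w.
  by move=> As; apply: wmax; rewrite mem_filter Al// andbT; exact/asboolP.
have [idx [idxN idxD idxt]] :=
  IH (fun s => A s /\ ~ D w s) (fun s As => Al s As.1).
exists (fun s => if `[< D w s >] then 0%N else (idx s).+1); split.
- by move=> s As; case: asboolP => // nD; rewrite ltnS idxN.
- move=> s t As At; case: asboolP => Ds; case: asboolP => Dt //.
    by exists w.
  by move=> [st]; rewrite ltnS => /(idxD _ _ (conj As Ds) (conj At Dt) st).
- move=> s As; case: asboolP => // nD [/idxt[]// t [At tD ht]].
  exists (fun i => if unlift ord0 i is Some j then t j else w); split.
  + by move=> i; case: unliftP => [j _|_] //; case: (At j).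
  + move=> i i'; case: unliftP => [j ->|->]; case: unliftP => [j' ->|->] //.
    * by rewrite (inj_eq lift_inj); exact: tD.
    * by move=> _ /Dsym; case: (At j).
    * by move=> _; case: (At j').
  + by move=> i; case: unliftP => [j _|_]; [exact: ht|exact: wmax].
Qed.

End Greedy.

(** * Convexity, symmetry and monotonicity of the balls [ballB U u] *)

Section BallGeometry.
Context {R : realType}.
Implicit Types (V : R -> R) (U : nat -> R -> R) (h s t a x y : nat -> R).

Lemma nneseries_EFin_leP h (K : R) : (forall i, 0 <= h i) ->
  (\sum_(0 <= i <oo) (h i)%:E <= K%:E)%E <->
  (forall n, \sum_(0 <= i < n) h i <= K).
Proof.
move=> h0; split=> [hK n|hK].
  rewrite -lee_fin -sumEFin; apply: le_trans hK.
  by apply: nneseries_lim_ge => i _ _; rewrite lee_fin.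
apply: lime_le; first by apply: is_cvg_nneseries => i _ _; rewrite lee_fin.
by apply: nearW => n; rewrite sumEFin lee_fin.
Qed.

Lemma ell2P t :
  ell2 t <-> exists K, forall n, \sum_(0 <= i < n) t i ^+ 2 <= K.
Proof.
have t0 i : 0 <= t i ^+ 2 by exact: sqr_ge0.
split=> [|[K /(nneseries_EFin_leP _ _ t0) tK]]; last first.
  by apply: le_lt_trans tK _; rewrite ltry.
move=> tfin; have fin : (\sum_(0 <= i <oo) (t i ^+ 2)%:E)%E \is a fin_num.
  rewrite ge0_fin_numE//; apply: nneseries_ge0 => i _ _.
  by rewrite lee_fin.
exists (fine (\sum_(0 <= i <oo) (t i ^+ 2)%:E)%E).
by apply/nneseries_EFin_leP => //; rewrite fineK.
Qed.

(* What convexity and the normalizations [V 0 = 0], [V 1 = 1] provide. *)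
Definition starlike V :=
  (forall z c, 0 <= z -> 0 <= c <= 1 -> V (c * z) <= c * V z) /\
  (forall z, 1 <= z -> z <= V z).

(** Convexity between [x] and 0 gives the first part; taking [c = x^-1] in it gives
    [1 = V 1 <= V x / x]. *)
Lemma convex_starlike V : @convex_function R R^o `[0, +oo[ V ->
  V 0 = 0 -> V 1 = 1 -> starlike V.
Proof.
move=> cV V0 V1.
have H (x c : R) : 0 <= x -> 0 <= c <= 1 -> V (c * x) <= c * V x.
  move=> x0 /andP[c0 c1].
  have := cV (Itv01 c0 c1) x 0; rewrite !inE/= !in_itv/= x0 lexx.
  move=> /(_ isT isT); rewrite !convRE /= V0 !mulr0 !addr0.
  by rewrite /conv/= scaler0 addr0.
split=> // x x1; have x0 : 0 < x by lra.
have := H x x^-1 (ltW x0).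
rewrite mulVf ?gt_eqF// V1 invr_ge0 ltW//= invf_le1//.
by move=> /(_ x1); rewrite mulrC ler_pdivlMr// mul1r.
Qed.

Section Ball.
Variable U : nat -> R -> R.
Hypothesis U_starlike : forall i, starlike (U i).

Lemma hatU_gt1 V z : starlike V -> 1 < `|z| -> `|z| <= hatU V z.
Proof.
move=> [_ V1] z1; rewrite /hatU (lt_geF z1).
by have := V1 _ (ltW z1); lra.
Qed.

Lemma hatU_ge0 V z : starlike V -> 0 <= hatU V z.
Proof.
move=> HV; have [z1|z1] := leP `|z| 1; first by rewrite /hatU z1 sqr_ge0.
by apply: le_trans (hatU_gt1 _ _ HV z1).
Qed.

Lemma hatUN V z : hatU V (- z) = hatU V z.
Proof. by rewrite /hatU normrN sqrrN. Qed.

Lemma hatUZ V z c : starlike V -> 0 <= c <= 1 -> hatU V (c * z) <= c * hatU V z.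
Proof.
move=> HV /andP[c0 c1]; have := HV => -[Vc V1].
rewrite /hatU normrM (ger0_norm c0) -[(c * z) ^+ 2]real_normK ?num_real//.
rewrite -[z ^+ 2]real_normK ?num_real// normrM (ger0_norm c0).
move: `|z| (normr_ge0 z) => {z} z z0.
(* In the mixed case [c * z <= 1 < z] the chain is [(c * z) ^+ 2 <= c * z <= c * V z <= c * (2 * V z
   - 1)]. *)
have [cz1|cz1] := leP (c * z) 1; have [z1|z1] := leP z 1.
- have := mulr_ge0 (mulr_ge0 c0 (sqr_ge0 z)) (_ : 0 <= 1 - c).
  by rewrite subr_ge0 => /(_ c1); lra.
- have := mulr_ge0 (mulr_ge0 c0 z0) (_ : 0 <= 1 - c * z).
  rewrite subr_ge0 => /(_ cz1).
  by have := mulr_ge0 c0 (_ : 0 <= V z - z); rewrite subr_ge0 V1 ?(ltW z1)//;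
    move=> /(_ isT); nra.
- by nra.
- by have := Vc z c z0; rewrite c0 c1 => /(_ isT); lra.
Qed.

(** The constraint of [normN] through partial sums, which is equivalent because [hatU] is
    nonnegative. *)
Definition admissible_at (u : R) a :=
  forall n, \sum_(0 <= i < n) hatU (U i) (a i) <= u.

(** Small coordinates have [a i ^+ 2 = hatU (U i) (a i)]; large ones have
    [|a i| <= hatU (U i) (a i) <= u], so their squares cost an extra factor [u]. *)
Lemma admissible_at_ell2 u a : admissible_at u a -> ell2 a.
Proof.
move=> au; apply/ell2P; exists (Num.max 1 u * u) => n.
have hi i : 0 <= hatU (U i) (a i) by exact: hatU_ge0.
apply: le_trans (_ : Num.max 1 u * \sum_(0 <= i < n) hatU (U i) (a i) <= _);
  last first.
  by rewrite ler_wpM2l// le_max ler01.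
rewrite mulr_sumr; apply: ler_sum => i _.
have [a1|a1] := leP `|a i| 1.
  by rewrite /hatU a1 ler_peMl ?sqr_ge0// le_max lexx.
have h1 := hatU_gt1 _ _ (U_starlike i) a1.
rewrite -real_normK ?num_real// expr2; apply: ler_pM => //.
rewrite le_max; apply/orP; right; apply: le_trans (au i.+1).
by rewrite big_nat_recr//=; apply: le_trans h1 _; rewrite lerDr sumr_ge0.
Qed.

Lemma ell2_cvg_series s t : ell2 s -> ell2 t ->
  cvgn (series (fun i => s i * t i)).
Proof.
move=> /ell2P[K sK] /ell2P[L tL]; apply: normed_cvg.
apply: nondecreasing_is_cvgn.
  by apply/nondecreasing_seqP => n; rewrite /= /series/= big_nat_recr//= lerDl.
exists (K + L) => _ [n _ <-]; rewrite /series/=.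
apply: le_trans (_ : \sum_(0 <= i < n) (s i ^+ 2 + t i ^+ 2) <= _); last first.
  by rewrite big_split lerD.
apply: ler_sum => i _; rewrite normrM -[s i ^+ 2]real_normK ?num_real//.
rewrite -[t i ^+ 2]real_normK ?num_real//.
by have := normr_ge0 (s i); have := normr_ge0 (t i); nra.
Qed.

Lemma ballBP u x : ballB U u x <-> ell2 x /\
  forall a, admissible_at u a -> limn (series (fun i => x i * a i)) <= u.
Proof.
have hi a i : 0 <= hatU (U i) (a i) by exact: hatU_ge0.
split=> -[x2 xu]; split=> //.
  move=> a au; rewrite -lee_fin; apply: le_trans xu.
  by apply: ereal_sup_ubound; exists a => //=; apply/nneseries_EFin_leP.
apply: ge_ereal_sup => _ [a /= /nneseries_EFin_leP au <-].
by rewrite lee_fin; apply: xu; apply: au.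
Qed.

Lemma ell2_lincomb c e x y : ell2 x -> ell2 y ->
  ell2 (fun i => c * x i + e * y i).
Proof.
move=> /ell2P[K xK] /ell2P[L yL]; apply/ell2P.
exists (2 * c ^+ 2 * K + 2 * e ^+ 2 * L) => n.
apply: le_trans (_ : \sum_(0 <= i < n)
    (2 * c ^+ 2 * x i ^+ 2 + 2 * e ^+ 2 * y i ^+ 2) <= _); last first.
  rewrite big_split/= -!mulr_sumr; apply: lerD; apply: ler_wpM2l => //.
    by rewrite mulr_ge0// sqr_ge0.
  by rewrite mulr_ge0// sqr_ge0.
apply: ler_sum => i _; rewrite -subr_ge0.
have -> : 2 * c ^+ 2 * x i ^+ 2 + 2 * e ^+ 2 * y i ^+ 2 -
  (c * x i + e * y i) ^+ 2 = (c * x i - e * y i) ^+ 2 by ring.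
exact: sqr_ge0.
Qed.

Lemma ballB_norm u x a : ballB U u x -> admissible_at u a ->
  `|limn (series (fun i => x i * a i))| <= u.
Proof.
move=> /ballBP[x2 xu] au; rewrite ler_norml xu// andbT.
have auN : admissible_at u (fun i => - a i).
  by move=> n; under eq_bigr do rewrite hatUN; exact: au.
have := xu _ auN; rewrite lerNl.
have -> : (fun i => x i * - a i) = (-1) *: (fun i => x i * a i).
  by apply/funext => i; rewrite /= scaleN1r mulrN.
rewrite lim_seriesZ ?scaleN1r//.
exact/ell2_cvg_series/admissible_at_ell2.
Qed.

(** Symmetry, averaging and shrinking in one form: it serves [phi_sym], [phi_common] and
    [phi_contract] in turn. *)
Lemma ballB_lincomb u c e x y : `|c| + `|e| <= 1 ->
  ballB U u x -> ballB U u y -> ballB U u (fun i => c * x i + e * y i).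
Proof.
move=> ce Bx By; have [x2 _] := Bx; have [y2 _] := By.
apply/ballBP; split; first exact: ell2_lincomb.
move=> a au; have a2 := admissible_at_ell2 _ _ au.
have -> : (fun i => (c * x i + e * y i) * a i) =
    c *: (fun i => x i * a i) + e *: (fun i => y i * a i).
  by apply/funext => i; rewrite mulrDl -!mulrA.
have cx := ell2_cvg_series _ _ x2 a2; have cy := ell2_cvg_series _ _ y2 a2.
rewrite lim_seriesD; [|exact: is_cvg_seriesZ..].
rewrite !lim_seriesZ//.
have := ballB_norm _ _ _ Bx au; have := ballB_norm _ _ _ By au.
move: (limn _) (limn _) => p q; rewrite /GRing.scale/= => pu qu.
apply: le_trans (ler_norm _) _; apply: le_trans (ler_normD _ _) _.
rewrite !normrM.
have := normr_ge0 c; have := normr_ge0 e; have := normr_ge0 p.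
by nra.
Qed.

(** A larger radius also admits more sequences [a]. If [a] is admissible at [v], then [hatUZ] makes
    [(u / v) * a] admissible at [u], and the bound [u] for it scales back to [v]. *)
Lemma ballB_mono u v x : 0 < u -> u <= v -> ballB U u x -> ballB U v x.
Proof.
move=> u0 uv /ballBP[x2 xu]; apply/ballBP; split=> // a av.
have v0 : 0 < v by exact: lt_le_trans uv.
pose c := u / v.
have c0 : 0 < c by rewrite /c divr_gt0.
have c01 : 0 <= c <= 1 by rewrite (ltW c0) /c ler_pdivrMr// mul1r.
have auc : admissible_at u (fun i => c * a i).
  move=> n; apply: le_trans (_ : c * v <= _); last first.
    by rewrite /c divfK// gt_eqF.
  apply: le_trans (_ : c * \sum_(0 <= i < n) hatU (U i) (a i) <= _); last first.
    by rewrite ler_pM2l.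
  by rewrite mulr_sumr; apply: ler_sum => i _; exact: hatUZ.
have := xu _ auc.
have -> : (fun i => x i * (c * a i)) = c *: (fun i => x i * a i).
  by apply/funext => i; rewrite /= mulrCA.
rewrite lim_seriesZ; last exact/ell2_cvg_series/admissible_at_ell2/av.
rewrite /GRing.scale/= mulrC -ler_pdivlMr//.
suff -> : u / c = v by [].
by rewrite /c; field; rewrite !gt_eqF.
Qed.

End Ball.
End BallGeometry.

(** * The functionals [phi] as substitutes for distances *)

Section Phi.
Context {R : realType}.
Variables (U : nat -> R -> R) (r : R).
Hypothesis U_starlike : forall i, starlike (U i).
Hypothesis r_ge2 : 2 <= r.
Implicit Types (s t w : nat -> R) (c u : R) (j : int).

Let r_gt0 : 0 < r. Proof. exact: lt_le_trans r_ge2. Qed.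

(** Quantifying over all [u > c] avoids asking whether the infimum is attained; [ballB_mono] passes
    from a near-optimal radius to [u]. *)
Lemma phi_leP j s t c : 0 < c -> (phi U r j s t <= c%:E)%E <->
  (forall u, c < u -> ballB U u (fun k => r ^ j * (s k - t k))).
Proof.
move=> c0; have rj : r ^ j != 0 by rewrite expfz_neq0// gt_eqF.
split=> [stc u cu|H].
  have : (phi U r j s t < u%:E)%E by apply: le_lt_trans stc _; rewrite lte_fin.
  move=> /ereal_inf_lt[_ [v /= [v0 [b bB bE]] <-]]; rewrite lte_fin => vu.
  apply: (ballB_mono _ U_starlike v) => //; first exact: ltW.
  suff -> : (fun k => r ^ j * (s k - t k)) = b by [].
  apply/funext => k; have := congr1 (fun f => f k) bE => /= <-.
  by rewrite -invr_expz mulVKf.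
apply/lee_addgt0Pr => e e0; rewrite -EFinD; apply: ereal_inf_lbound.
exists (c + e) => //; split; first by rewrite addr_gt0.
exists (fun k => r ^ j * (s k - t k)); first by apply: H; rewrite ltrDl.
by apply/funext => k /=; rewrite -invr_expz mulKf.
Qed.

Lemma phi_sym j s t c : 0 < c ->
  (phi U r j s t <= c%:E)%E -> (phi U r j t s <= c%:E)%E.
Proof.
move=> c0 /(phi_leP _ _ _ _ c0) H; apply/phi_leP => // u cu.
have -> : (fun k => r ^ j * (t k - s k)) =
    (fun k => -1 * (r ^ j * (s k - t k)) + 0 * (r ^ j * (s k - t k))).
  by apply/funext => k; rewrite mul0r addr0 mulN1r -mulrN opprB.
apply: ballB_lincomb => //; try exact: H.
by rewrite normrN1 normr0 addr0.
Qed.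

(** Here the triangle inequality costs one unit of [j]: the two differences enter with weights of
    modulus [r^-1], and [2 / r <= 1]. *)
Lemma phi_common j s t w c : 0 < c ->
  (phi U r (j + 1) w s <= c%:E)%E -> (phi U r (j + 1) w t <= c%:E)%E ->
  (phi U r j s t <= c%:E)%E.
Proof.
move=> c0 /(phi_leP _ _ _ _ c0) ws /(phi_leP _ _ _ _ c0) wt.
apply/phi_leP => // u cu.
have -> : (fun k => r ^ j * (s k - t k)) =
    (fun k => - r^-1 * (r ^ (j + 1) * (w k - s k)) +
              r^-1 * (r ^ (j + 1) * (w k - t k))).
  apply/funext => k; rewrite expfzDr ?gt_eqF// expr1z.
  by move: (r ^ j) => x; field; rewrite gt_eqF.
apply: ballB_lincomb => //; [|exact: ws|exact: wt].
rewrite normrN gtr0_norm ?invr_gt0// -mulr2n -mulr_natr mulrC.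
by rewrite ler_pdivrMr// mul1r.
Qed.

(** The inclusion writes [r ^ (j + 1) * (s - t)] as [8 * rho] times a point of the ball, and
    [8 * rho < 1]. Its contrapositive yields the separation required by [gc_growth]. *)
Lemma phi_contract (rho : R) j s t c : 0 < c -> 0 < rho < 10^-1 ->
  (forall u, 0 < u -> ballB U (8 * r * u) `<=` dilate (rho * r) (ballB U u)) ->
  (phi U r (j + 2) (fun k => s k / 8)%R (fun k => t k / 8)%R
    <= (8 * r * c)%:E)%E ->
  (phi U r (j + 1) s t <= c%:E)%E.
Proof.
move=> c0 /andP[rho0 rho1] HB.
have r8 : 0 < 8 * r by rewrite mulr_gt0.
move=> /phi_leP H; apply/phi_leP => // u cu.
have u0 : 0 < u by exact: lt_trans cu.
have := H _ (8 * r * u); rewrite mulr_gt0// ltr_pM2l// => /(_ isT cu).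
move=> /(HB _ u0)[b bB bE].
have -> : (fun k => r ^ (j + 1) * (s k - t k)) =
    (fun k => (8 * rho) * b k + 0 * b k).
  apply/funext => k; have /= := congr1 (fun f => f k) bE.
  rewrite (_ : j + 2 = j + 1 + 1); last by rewrite -addrA.
  rewrite [r ^ (j + 1 + 1)]expfzDr ?gt_eqF// expr1z => bk.
  apply: (mulfI (lt0r_neq0 r_gt0)); move: bk.
  by move: (r ^ (j + 1)) => x; lra.
apply: ballB_lincomb => //.
by rewrite normr0 addr0 gtr0_norm; lra.
Qed.

End Phi.

(** * Construction of the refining partitions and the bound on [gamma] *)

Section Refinement.
Context {R : realType}.
Variables (U : nat -> R -> R) (r rho : R) (kappa sigma : nat).
Variables (T : set (nat -> R)) (f : nat -> int -> (nat -> R) -> R).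
Hypothesis U_starlike : forall i, starlike (U i).
Hypothesis r_ge4 : 4 <= r.
Hypothesis rE : 2 ^+ kappa = 8 * r.
Hypothesis kappa_gt0 : (0 < kappa)%N.
Hypothesis rho_bound : 0 < rho < 10^-1.
Hypothesis ballB_contract : forall u, 0 < u ->
  ballB U (8 * r * u) `<=` dilate (rho * r) (ballB U u).
Hypothesis T_finite : finite_set T.
Hypothesis growth : growth_condition U r kappa sigma T f.

Fixpoint cell_bound (m : nat) : nat :=
  if m is m'.+1 then (cell_bound m' * Nn (m' * kappa + kappa))%N else 1%N.

(* A partition of [T] is coded by a map [c], constant on its cells; [J] gives
   each cell [A] an integer below [jsup U r (m * kappa) A]. *)
Definition coded_partition m (c : (nat -> R) -> nat) (J : (nat -> R) -> int) :=
  (forall t, T t -> (c t < cell_bound m)%N) /\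
  (forall s t, T s -> T t -> c s = c t ->
    J s = J t /\ (phi U r (J s) s t <= (2 ^+ (m * kappa))%:E)%E).

Definition gain_step m (J J' : (nat -> R) -> int) t :=
  J' t = J t + sigma%:Z \/
  (J' t = J t /\
   f (m.+1 * kappa)%N (J t + sigma%:Z + 2) t +
     (8 * r) ^+ m * r ^ (- (J t + sigma%:Z)) <= f (m * kappa)%N (J t - 1) t).

(** For a leftover point [s], [gc_growth] is applied with centre [s] and [j = J s + sigma]: the
    selected points share the cell of [s], so they lie in the required ball of index
    [j - sigma = J s]. *)
Lemma split_cell m c J N v : coded_partition m c J ->
  Nn (m * kappa + kappa) = N.+1 ->
  exists idx : (nat -> R) -> nat,
  [/\ forall s, T s -> c s = v -> (idx s <= N)%N,
      forall s t, T s -> T t -> c s = v -> c t = v -> idx s = idx t ->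
        (idx s < N)%N ->
        (phi U r (J s + sigma%:Z) s t <= (2 ^+ (m * kappa))%:E)%E &
      forall s, T s -> c s = v -> idx s = N ->
        f (m.+1 * kappa)%N (J s + sigma%:Z + 2) s +
          (8 * r) ^+ m * r ^ (- (J s + sigma%:Z)) <=
        f (m * kappa)%N (J s - 1) s].
Proof.
move=> [_ cJ] NE.
have q0 n : 0 < 2 ^+ n :> R by rewrite exprn_gt0.
have r2 : 2 <= r by apply: le_trans r_ge4; rewrite ler_nat.
have [[s0 [Ts0 cs0]]|empty] := pselect (exists s, T s /\ c s = v); last first.
  exists (fun=> 0%N); split=> [s Ts cs|s t Ts _ cs|s Ts cs];
    by case: empty; exists s.
have JE s : T s -> c s = v -> J s = J s0.
  by move=> Ts cs; have [] := cJ s s0 Ts Ts0; rewrite ?cs ?cs0.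
have /finite_seqP[l lE] := T_finite.
(* The extra 1 in the index pays for [phi_common], applied to two points near one centre. *)
pose D w s := (phi U r (J s0 + sigma%:Z + 1) w s <= (2 ^+ (m * kappa))%:E)%E.
have [idx [idxN idxD idxt]] := @greedy_partition R (nat -> R) D
  (f (m.+1 * kappa)%N (J s0 + sigma%:Z + 2)) N (fun s => T s /\ c s = v) l
  (fun s t => phi_sym _ _ U_starlike r2 _ _ _ _ (q0 _))
  (fun s Ts => eq_rect _ (fun A : set (nat -> R) => A s) Ts.1 _ lE).
exists idx; split.
- by move=> s Ts cs; exact: idxN.
- move=> s t Ts Tt cs ct st sN.
  have [w Ds Dt] := idxD _ _ (conj Ts cs) (conj Tt ct) st sN.
  by rewrite JE//; exact: phi_common Ds Dt.
- move=> s Ts cs /(idxt _ (conj Ts cs))[t [At tD ht]].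
  have := @gc_growth _ _ _ _ _ _ _ growth (m * kappa)%N (J s + sigma%:Z).
  rewrite NE addrK => /(_ t s (fun i => (At i).1)) G.
  have -> : (m.+1 * kappa = m * kappa + kappa)%N by rewrite mulSn addnC.
  rewrite -rE -exprM [(kappa * m)%N]mulnC addrC; apply: le_trans (G _ Ts _).
  (* By the greedy choice every [t i] has a value of [f] at least that of [s]. *)
  + rewrite lerD2l; apply: lb_le_inf.
      exists (f (m * kappa + kappa)%N (J s + sigma%:Z + 2) (t ord0)).
      by exists ord0.
    move=> _ [i _ <-]; rewrite JE//; have := ht i.
    by rewrite mulSn addnC.
  + move=> i i' /tD; rewrite /D => nD; rewrite ltNge; apply/negP => h.
    apply: nD; apply: (phi_contract _ _ U_starlike r2 rho) => //.
    by rewrite -rE -exprD addnC -(JE s).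
  + move=> i; split; first exact: (At i).1.
    have [Ti ci] := At i.
    by have [] := cJ s (t i) Ts Ti; rewrite ?cs ?ci.
Qed.

Lemma refine_exists m c J : coded_partition m c J ->
  exists c' J', [/\ coded_partition m.+1 c' J',
    forall s t, T s -> T t -> c' s = c' t -> c s = c t &
    forall t, T t -> gain_step m J J' t].
Proof.
move=> cJ; have [N NE] : exists N, Nn (m * kappa + kappa) = N.+1.
  exists (Nn (m * kappa + kappa)).-1; rewrite prednK// /Nn.
  by case: (_ + _)%N => // n; rewrite expn_gt0.
have /choice[idx idxP] := fun v => split_cell m c J N v cJ NE.
have idxN s : T s -> (idx (c s) s < N.+1)%N.
  by move=> Ts; have [+ _ _] := idxP (c s); exact.
have [cK cJ2] := cJ.
(* As [idx] stays below [N.+1], quotient and remainder recover the old cell and the piece. *)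
exists (fun t => c t * N.+1 + idx (c t) t)%N.
exists (fun t => if idx (c t) t == N then J t else J t + sigma%:Z).
have code s t : T s -> T t ->
    (c s * N.+1 + idx (c s) s = c t * N.+1 + idx (c t) t)%N ->
    c s = c t /\ idx (c s) s = idx (c t) t.
  move=> Ts Tt e; split.
    have := congr1 (divn^~ N.+1) e.
    by rewrite !divnMDl// !divn_small ?idxN// !addn0.
  have := congr1 (modn^~ N.+1) e.
  by rewrite !modnMDl !modn_small ?idxN.
split.
- split=> [t Tt|s t Ts Tt /(code _ _ Ts Tt)[cst ist]].
    rewrite /= NE; apply: (@leq_trans ((c t).+1 * N.+1)); last first.
      by rewrite leq_mul2r cK// orbT.
    by rewrite mulSn addnC ltn_add2r idxN.
  have [JE phist] := cJ2 _ _ Ts Tt cst.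
  rewrite -ist JE; split=> //.
  have le2 : ((2 ^+ (m * kappa))%:E <= (2 ^+ (m.+1 * kappa))%:E :> \bar R)%E.
    by rewrite lee_fin ler_weXn2l ?ler1n// leq_mul2r leqnSn orbT.
  apply: le_trans le2; case: eqP => [_|/eqP iN]; first by rewrite -JE.
  have [_ /(_ s t Ts Tt erefl (esym cst)) + _] := idxP (c s).
  rewrite -JE; apply; first by rewrite ist cst.
  by rewrite ltn_neqAle iN -ltnS idxN.
- by move=> s t Ts Tt /(code _ _ Ts Tt)[].
- move=> t Tt; rewrite /gain_step; case: eqP => [iN|_]; last by left.
  by right; split=> //; have [_ _ /(_ _ Tt erefl iN)] := idxP (c t).
Qed.


Lemma coded_sequence (J0 : int) :
  (forall s t, T s -> T t -> (phi U r J0 s t <= 1%:E)%E) ->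
  exists c J, [/\ forall t, J 0%N t = J0,
    forall m, coded_partition m (c m) (J m),
    forall m s t, T s -> T t -> c m.+1 s = c m.+1 t -> c m s = c m t &
    forall m t, T t -> gain_step m (J m) (J m.+1) t].
Proof.
move=> J0P.
pose state := (((nat -> R) -> nat) * ((nat -> R) -> int))%type.
(* Stating [next] as an implication makes it solvable for every state, so that [choice] applies; the
   premise is restored by induction in [stP]. *)
pose next (p : nat * state) (p' : state) := coded_partition p.1 p.2.1 p.2.2 ->
  [/\ coded_partition p.1.+1 p'.1 p'.2,
    forall s t, T s -> T t -> p'.1 s = p'.1 t -> p.2.1 s = p.2.1 t &
    forall t, T t -> gain_step p.1 p.2.2 p'.2 t].
have /choice[nxt nxtP] : forall p, exists p', next p p'.
  move=> p; have [cp|ncp] := pselect (coded_partition p.1 p.2.1 p.2.2).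
    by have [c' [J' ?]] := refine_exists _ _ _ cp; exists (c', J').
  by exists p.2.
pose st := fix st m : state :=
  if m is m'.+1 then nxt (m', st m') else (fun=> 0%N, fun=> J0).
have stP m : coded_partition m (st m).1 (st m).2.
  elim: m => [|m IH]; last by have [] := nxtP (m, st m) IH.
  by split=> // s t Ts Tt _; split=> //; rewrite mul0n expr0; exact: J0P.
exists (fun m => (st m).1), (fun m => (st m).2); split=> // m.
  by have [_ + _] := nxtP (m, st m) (stP m).
by have [_ _] := nxtP (m, st m) (stP m).
Qed.

(** The product of the splitting numbers up to time [m] is at most [Nn (m * kappa).+1], by
    [Nn k * Nn k = Nn k.+1] for [k > 0]. The predecessor in [n.-1 %/ kappa] absorbs this extra
    level. *)
Lemma cell_bound_le n : (cell_bound (n.-1 %/ kappa) <= Nn n)%N.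
Proof.
have Nn_mono p k : (0 < p)%N -> (p <= k)%N -> (Nn p <= Nn k)%N.
  by case: p => // p _; case: k => // k pk; rewrite !leq_pexp2l.
have bound m : (cell_bound m <= Nn (m * kappa).+1)%N.
  elim: m => // m IH; rewrite [cell_bound m.+1]/=.
  apply: (@leq_trans (Nn (m * kappa + kappa) * Nn (m * kappa + kappa))).
    rewrite leq_mul2r; apply/orP; right; apply: leq_trans IH _.
    by apply: Nn_mono => //; rewrite -addn1 leq_add2l.
  have -> : (m.+1 * kappa = m * kappa + kappa)%N by rewrite mulSn addnC.
  have : (0 < m * kappa + kappa)%N by rewrite ltn_addl.
  case: (m * kappa + kappa)%N => // k _.
  by rewrite /Nn -expnD addnn -mul2n -expnS.
case: n => [|n]; first by rewrite div0n.
apply: leq_trans (bound _) _; apply: Nn_mono => //.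
by rewrite ltnS leq_trunc_div.
Qed.

Definition cells (c : (nat -> R) -> nat) : set (set (nat -> R)) :=
  [set [set s | T s /\ c s = c t] | t in T].

Lemma pblock_cells c t : T t ->
  pblock (cells c) id t = [set s | T s /\ c s = c t].
Proof.
move=> Tt; rewrite /pblock /pblock_index.
have [] := @getPex _ (fun A => cells c A /\ A t).
  by exists [set s | T s /\ c s = c t]; split=> //; exists t.
move=> [u Tu <-] [_ /= ct]; apply/seteqP.
by split=> s /= [Ts cs]; split; rewrite // cs ct.
Qed.

Lemma cells_admissible (c : nat -> (nat -> R) -> nat) :
  (forall n t, T t -> (c n t < Nn n)%N) ->
  (forall n s t, T s -> T t -> c n.+1 s = c n.+1 t -> c n s = c n t) ->
  admissible T (fun n => cells (c n)).
Proof.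
move=> cN cref; split=> [n|n|n A [t Tt <-]].
- split.
  + apply/seteqP; split=> [s [_ [t Tt <-]] []//|s Ts].
    by exists [set s' | T s' /\ c n s' = c n s] => //; exists s.
  + move=> _ _ [s Ts <-] [t Tt <-] [u [[_ us] [_ ut]]].
    by rewrite -us -ut.
  + by move=> _ [t Tt <-]; exists t.
- apply: (@card_le_trans _ _ _
    ((fun v => [set s | T s /\ c n s = v]) @` `I_(Nn n))).
    by apply: subset_card_le => _ [t Tt <-]; exists (c n t) => //=; exact: cN.
  exact: card_image_le.
- exists [set s | T s /\ c n s = c n t]; first by exists t.
  by move=> s /= [Ts cs]; split=> //; exact: cref.
Qed.

(** Each [m] serves the [kappa] indices from [m * kappa + 1] to [m * kappa + kappa]; index 0 adds
    one more [b 0]. *)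
Lemma sum_slowed (b : nat -> R) M :
  \sum_(n < (M * kappa).+1) b (n.-1 %/ kappa)%N =
  b 0%N + kappa%:R * \sum_(m < M) b m.
Proof.
elim: M => [|M IH].
  by rewrite mul0n big_ord_recl !big_ord0 div0n mulr0.
rewrite mulSn addnC -addSn big_split_ord/= IH big_ord_recr/= mulrDr addrA.
congr (_ + _); rewrite (eq_bigr (fun=> b M)) => [|i _].
  by rewrite sumr_const card_ord mulr_natl.
by rewrite divnMDl// divn_small// addn0.
Qed.

Lemma rpowN_ge0 (y : \bar R) : (0 <= rpowN r y)%E.
Proof. by case: y => [y| |] //=; rewrite lee_fin powR_ge0. Qed.

Lemma rpowN_jsup_le n A (j : int) :
  (forall s t, A s -> A t -> (phi U r j s t <= (2 ^+ n)%:E)%E) ->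
  (rpowN r (jsup U r n A) <= (r ^ (- j))%:E)%E.
Proof.
move=> Aj; have : ((j%:~R)%:E <= jsup U r n A)%E.
  by apply: ereal_sup_ubound; exists j.
have r_gt0 : 0 < r by exact: lt_le_trans r_ge4.
case: jsup => [y| |] //=; rewrite !lee_fin => h; last first.
  by rewrite exprz_ge0// ltW.
rewrite -powR_intmul ?(ltW r_gt0)// mulrNz ler_powR ?lerN2//.
by apply: le_trans r_ge4; rewrite ler1n.
Qed.

Hypothesis sigma_ge4 : (4 <= sigma)%N.

(** The starting label is a parameter because [jsup U r 0 T] may be infinite, for instance for a
    single point. *)
Lemma gamma_le_label (S : R) (J0 : int) : 0 <= S ->
  (forall n j t, T t -> 0 <= f n j t <= S) ->
  (forall s t, T s -> T t -> (phi U r J0 s t <= 1%:E)%E) ->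
  (gamma U r T <= (8 * r * (r ^ (- J0) + kappa%:R * (3 * (r ^ (- J0) +
     (sigma + 2)%:R * S * (8 * r * r ^+ sigma)))))%:E)%E.
Proof.
move=> S0 fS J0P; have r_gt0 : 0 < r by exact: lt_le_trans r_ge4.
set B := 8 * r * _.
have rz (j : int) : 0 <= r ^ j by rewrite exprz_ge0// ltW.
have [c [J [J0E cJ cref gain]]] := coded_sequence _ J0P.
have crefs m m' s t : (m <= m')%N -> T s -> T t ->
    c m' s = c m' t -> c m s = c m t.
  move=> mm' Ts Tt; rewrite -(subnKC mm'); elim: (m' - m)%N => [|d IH].
    by rewrite addn0.
  by rewrite addnS => /(cref _ _ _ Ts Tt)/IH.
pose cc n := c (n.-1 %/ kappa)%N.
have adm : admissible T (fun n => cells (cc n)).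
  apply: cells_admissible => [n t Tt|n s t Ts Tt].
    apply: leq_trans (cell_bound_le n).
    by case: (cJ (n.-1 %/ kappa)%N) => + _; exact.
  by apply: crefs => //; rewrite leq_div2r// leq_pred.
apply: (@le_trans _ _ (nnsup [set (\sum_(0 <= n <oo)
      (2 ^+ n)%:E * rpowN r (jsup U r n (pblock (cells (cc n)) id t)))%E
      | t in T])).
  by apply: ereal_inf_lbound; exists (fun n => cells (cc n)).
have sumB t M : T t -> \sum_(n < M) 2 ^+ n * r ^ (- J (n.-1 %/ kappa)%N t) <= B.
  move=> Tt; pose a m := (8 * r) ^+ m * r ^ (- J m t).
  have a0 m : 0 <= a m.
    by rewrite /a mulr_ge0 ?exprz_ge0 ?exprn_ge0 ?mulr_ge0 ?ltW.
  apply: (@le_trans _ _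
    (8 * r * \sum_(n < (M * kappa).+1) a (n.-1 %/ kappa)%N)).
    have MM : (M <= (M * kappa).+1)%N.
      by rewrite (leq_trans (leq_pmulr _ kappa_gt0)).
    rewrite -(big_mkord xpredT (fun n => a (n.-1 %/ kappa)%N)).
    rewrite (big_cat_nat (leq0n _) MM)/= mulrDr -[leLHS]addr0.
    apply: lerD; last by rewrite mulr_ge0 ?sumr_ge0// mulr_ge0// ltW.
    rewrite big_mkord mulr_sumr; apply: ler_sum => n _.
    rewrite /a mulrA ler_wpM2r//.
    rewrite -exprS -rE -exprM ler_weXn2l ?ler1n//.
    (* With [m = n.-1 %/ kappa] one has [n <= (m + 1) * kappa], hence
       [2 ^+ n <= 8 * r * (8 * r) ^+ m]. *)
    rewrite mulnC; apply: leq_trans (leqSpred n) _.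
    exact: ltn_ceil.
  rewrite sum_slowed; apply: ler_wpM2l; first by rewrite mulr_ge0// ltW.
  have aE : a 0%N = r ^ (- J0) by rewrite /a J0E expr0 mul1r.
  rewrite aE lerD2l ler_wpM2l// -aE.
  apply: (@weighted_sum_bound R r sigma (fun m j => f (m * kappa)%N j t)
    (fun m => J m t) S r_ge4 sigma_ge4 (fun m j => fS _ _ _ Tt)) => [m j|m j|m].
  - rewrite mulSn addnC.
    by have := gc_mono growth (m * kappa) j Tt; rewrite ge_max => /andP[].
  - by have := gc_mono growth (m * kappa) j Tt; rewrite ge_max => /andP[].
  - exact: gain.
have B0 : 0 <= B.
  rewrite /B mulr_ge0 ?mulr_ge0 ?(ltW r_gt0)//.
  rewrite addr_ge0// mulr_ge0// mulr_ge0// addr_ge0// !mulr_ge0 ?(ltW r_gt0)//.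
  by rewrite exprn_ge0// ltW.
apply: ge_ereal_sup => _ [->|[t Tt <-]]; first by rewrite lee_fin.
apply: (@le_trans _ _
  (\sum_(0 <= n <oo) (2 ^+ n * r ^ (- J (n.-1 %/ kappa)%N t))%:E)%E).
  apply: lee_nneseries => [n _ _|n _].
    by rewrite mule_ge0 ?rpowN_ge0// lee_fin exprn_ge0.
  rewrite EFinM lee_wpmul2l ?lee_fin ?exprn_ge0// pblock_cells//.
  apply: rpowN_jsup_le => s s' /= [Ts cs] [Ts' cs'].
  have [_ cell] := cJ (n.-1 %/ kappa)%N.
  have [<- _] := cell _ _ Ts Tt cs.
  have [_ h] := cell _ _ Ts Ts' (etrans cs (esym cs')).
  apply: le_trans h _; rewrite lee_fin ler_weXn2l ?ler1n//.
  by apply: leq_trans (leq_trunc_div _ _) (leq_pred n).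
apply/nneseries_EFin_leP => [n|n]; first by rewrite mulr_ge0// exprn_ge0.
by rewrite big_mkord; exact: sumB.
Qed.

End Refinement.

(** * Choice of the constants and passage from integer labels to [jsup U r 0 T] *)

Theorem theorem6p2 (R : realType) (C0 : R) (kappa : nat) (hkappa : (5 <= kappa)%N) :
  let r : R := 2 ^+ (kappa - 3) in
  exists sigma0 : nat, forall sigma : nat, (sigma0 <= sigma)%N ->
  exists2 C : R, 0 < C &
  forall (d : measure_display) (Omega : measurableType d)
    (P : probability Omega R) (Y : nat -> {RV P >-> R}),
    process_hypotheses C0 Y ->
    let U := fun i : nat => tail_exponent (Y i) in
    (exists rho : R, 0 < rho < 10^-1 /\
      forall u : R, 0 < u ->
        ballB U (8 * r * u) `<=` dilate (rho * r) (ballB U u)) ->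
  forall T : set (nat -> R), finite_set T -> T `<=` ell2 ->
  forall f : nat -> int -> (nat -> R) -> R,
    (forall n j t, T t -> 0 <= f n j t) ->
    growth_condition U r kappa sigma T f ->
    (gamma U r T <=
      C%:E * (nnsup [set x | exists n j u, T u /\ x = (f n j u)%:E]
              + rpowN r (jsup U r 0 T)))%E.
Proof.
move=> r; have r_ge4 : 4 <= r.
  have -> : 4 = 2 ^+ 2 :> R by rewrite expr2 -natrM.
  by rewrite ler_weXn2l ?ler1n//; lia.
have r_gt0 : 0 < r by exact: lt_le_trans r_ge4.
have r_ge1 : 1 <= r by apply: le_trans r_ge4; rewrite ler1n.
have rE : 2 ^+ kappa = 8 * r.
  have -> : kappa = (3 + (kappa - 3))%N by lia.
  rewrite exprD; congr (_ * _).
  by rewrite !exprS expr0 mulr1 -!natrM.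
exists 4%N => sigma sigma4.
pose p : R := (sigma + 2)%:R * (8 * r * r ^+ sigma).
have p0 : 0 <= p by rewrite !mulr_ge0 ?exprn_ge0 ?(ltW r_gt0).
pose k3 : R := 1 + 3 * kappa%:R.
have k3_ge1 : 1 <= k3 by rewrite lerDl mulr_ge0.
pose C1 : R := 8 * r * (k3 * (1 + p)).
have C1_gt0 : 0 < C1.
  by rewrite !mulr_gt0//; [exact: lt_le_trans k3_ge1|rewrite ltr_pwDl].
(* [C1] comes from [gamma_le_label]; the factor [r] pays for a label less than 1 below
   [jsup U r 0 T]. *)
exists (r * C1); first by rewrite mulr_gt0.
move=> d Omega P Y HY U [rho [rho01 HB]] T Tfin _ f f0 growth.
have U_starlike i : starlike (U i).
  exact: convex_starlike (ph_convex HY i) (ph_at0 HY i) (ph_at1 HY i).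
set F := nnsup _.
have F0 : (0 <= F)%E by apply: ereal_sup_ubound; left.
have fF n j t : T t -> ((f n j t)%:E <= F)%E.
  by move=> Tt; apply: ereal_sup_ubound; right; exists n, j, t.
have C_gt0 : (0 < (r * C1)%:E)%E by rewrite lte_fin mulr_gt0.
(* If the supremum of [f] is infinite, so is the right-hand side. *)
case: F F0 fF => [S| |]//; rewrite ?lee_fin => S0 fS; last first.
  by rewrite addye ?gt0_muley ?leey// gt_eqF// (lt_le_trans _ (rpowN_ge0 _ _)).
have label j : (forall s t, T s -> T t -> (phi U r j s t <= 1%:E)%E) ->
    (gamma U r T <= (C1 * (S + r ^ (- j)))%:E)%E.
  move=> jP.
  apply: le_trans (gamma_le_label U r rho kappa sigma T f U_starlike r_ge4 rE
    _ rho01 HB Tfin growth sigma4 S j S0 _ jP) _; first exact: leq_trans hkappa.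
    by move=> n i t Tt; rewrite f0// -lee_fin fS.
  rewrite lee_fin /C1 -(mulrA (8 * r)) ler_pM2l ?mulr_gt0//.
  have x0 : 0 <= r ^ (- j) by rewrite exprz_ge0// ltW.
  move: (r ^ _) x0 => x x0.
  have -> : (sigma + 2)%:R * S * (8 * r * r ^+ sigma) = p * S.
    by rewrite /p; ring.
  rewrite -subr_ge0; have -> : k3 * (1 + p) * (S + x) -
    (x + kappa%:R * (3 * (x + p * S))) = k3 * S + k3 * (p * x) + p * S.
    by rewrite /k3; ring.
  have k30 : 0 <= k3 by exact: le_trans k3_ge1.
  have px0 : 0 <= p * x by exact: mulr_ge0.
  by apply: addr_ge0; [apply: addr_ge0|]; apply: mulr_ge0.
have powE (j : int) : r ^ (- j) = r `^ (- j%:~R).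
  by rewrite -powR_intmul ?(ltW r_gt0)// mulrNz.
case j0E : (jsup U r 0 T) => [y| |] /=; last first.
- by rewrite addey// gt0_muley ?leey.
- rewrite adde0; apply/lee_addgt0Pr => e e0.
  (* A label [j > k] makes the remainder small: [C1 * r ^ (- j) <= C1 / r ^+ k <= e], since
     [C1 / e <= k <= r ^+ k]. *)
  pose k := Num.bound (C1 / e).
  have : ((k%:R)%:E < jsup U r 0 T)%E by rewrite j0E ltry.
  move=> /ereal_sup_gt[_ [j jP <-]]; rewrite lte_fin => kj.
  apply: le_trans (label j jP) _; rewrite -EFinM -EFinD lee_fin mulrDr.
  apply: lerD.
    by apply: ler_wpM2r => //; rewrite ler_peMl// ltW.
  have kr : k%:R <= r ^+ k.
    apply: (@le_trans _ _ (2 ^+ k)).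
      by rewrite -natrX ler_nat ltnW// ltn_expl.
    rewrite lerXn2r ?nnegrE ?(ltW r_gt0)//.
    by apply: le_trans r_ge4; rewrite ler_nat.
  have jr : r ^ (- j) <= (r ^+ k)^-1.
    by rewrite powE -powR_invn ?(ltW r_gt0)// ler_powR// lerN2 ltW.
  apply: le_trans (_ : C1 / r ^+ k <= _); first by rewrite ler_pM2l.
  rewrite ler_pdivrMr ?exprn_gt0// mulrC -ler_pdivrMr//.
  apply: le_trans kr; apply: ltW; apply: archi_boundP.
  by rewrite divr_ge0// ltW.
(* Attainment of the supremum is avoided: a label [j > y - 1] gives [r ^ (- j)] at most [r] times r
   to the power [- y]. *)
- have : ((y - 1)%:E < jsup U r 0 T)%E by rewrite j0E lte_fin ltrBlDr ltrDl.
  move=> /ereal_sup_gt[_ [j jP <-]]; rewrite lte_fin => yj.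
  apply: le_trans (label j jP) _; rewrite -EFinD -EFinM lee_fin.
  rewrite (mulrC r) -(mulrA C1) ler_pM2l// mulrDr; apply: lerD.
    by rewrite ler_peMl.
  rewrite powE -{2}(powRr1 (ltW r_gt0)) -powRD; last first.
    by rewrite (gt_eqF r_gt0) implybT.
  by rewrite ler_powR//; lra.
Qed.
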